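(* For every integer $n\geq 2$, each of the pairs $(\ell_1^n,\mathbb{K})$ and $(\ell_\infty^n,\mathbb{K})$ fails both property $\mathbf{L}_{p,o}$ and property $\mathbf{L}_{o,p}$.
   Context: Banach spaces are over $\mathbb{K}$, which is $\mathbb{R}$ or $\mathbb{C}$. $\ell_p^n$ denotes $\mathbb{K}^n$ endowed with the $p$-norm. $S_X$ denotes the unit sphere of $X$, and $\mathcal{L}(X,Y)$ the space of bounded linear operators from $X$ to $Y$ with the operator norm (so $\mathcal{L}(X,\mathbb{K})=X^*$). A pair $(X,Y)$ of Banach spaces has property $\mathbf{L}_{p,o}$ if for every $\varepsilon>0$ and every $T\in\mathcal{L}(X,Y)$ with $\|T\|=1$ there is $\eta(\varepsilon,T)>0$ such that whenever $x\in S_X$ satisfies $\|T(x)\|>1-\eta(\varepsilon,T)$, there is $S\in\mathcal{L}(X,Y)$ with $\|S\|=1$, $\|S(x)\|=1$ and $\|S-T\|<\varepsilon$. A pair $(X,Y)$ of Banach spaces has property $\mathbf{L}_{o,p}$ if for every $\varepsilon>0$ and every $x\in S_X$ there is $\eta(\varepsilon,x)>0$ such that whenever $T\in\mathcal{L}(X,Y)$ with $\|T\|=1$ satisfies $\|T(x)\|>1-\eta(\varepsilon,x)$, there is $x_0\in S_X$ with $\|T(x_0)\|=1$ and $\|x_0-x\|<\varepsilon$. *)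

(* Defs.v *)
From HB Require Import structures.
From mathcomp Require Import all_boot all_order all_algebra.
From mathcomp Require Import all_classical all_reals all_analysis.
From mathcomp Require Import complex.

Set Implicit Arguments.
Unset Strict Implicit.
Unset Printing Implicit Defensive.

Import Order.TTheory GRing.Theory Num.Theory.
Import numFieldNormedType.Exports.

Local Open Scope classical_set_scope.
Local Open Scope ring_scope.

(* As everywhere in mathcomp-analysis, real quantities (norms, e, eta) live in
   the scalar field K itself: in K = R[i], [0 < e] means that e is a positive
   real, and norms are nonnegative reals.  [opnorm T] is likewise an element of
   K; by [opnorm_isLub] below it is a genuine least upper bound, not the default
   value 0 of [supremum], whenever K is R or R[i] and T is bounded. *)
Section local_BPB_properties.
Context {K : numFieldType}.

Definition opnorm {X Y : normedModType K} (T : X -> Y) : K :=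
  supremum 0 [set `|T x| | x in [set x : X | `|x| <= 1]].

Variables X Y : completeNormedModType K.

Definition bounded_operator (T : {linear X -> Y}) : Prop :=
  bounded_near T (nbhs (0 : X)).

Definition property_Lpo : Prop :=
  forall (e : K) (T : {linear X -> Y}),
    0 < e -> bounded_operator T -> opnorm T = 1 ->
  exists2 eta : K, 0 < eta &
    forall x : X, `|x| = 1 -> 1 - eta < `|T x| ->
    exists S : {linear X -> Y},
      [/\ bounded_operator S, opnorm S = 1, `|S x| = 1 & opnorm (S \- T) < e].

Definition property_Lop : Prop :=
  forall (e : K) (x : X), 0 < e -> `|x| = 1 ->
  exists2 eta : K, 0 < eta &
    forall T : {linear X -> Y},
      bounded_operator T -> opnorm T = 1 -> 1 - eta < `|T x| ->
    exists x0 : X, [/\ `|x0| = 1, `|T x0| = 1 & `|x0 - x| < e].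

End local_BPB_properties.
Arguments property_Lpo {K} X Y.
Arguments property_Lop {K} X Y.

Definition l1_space (K : numFieldType) (n : nat) : Type := 'rV[K]_n.

Section l1_norm.
Variables (K : numFieldType) (n : nat).

HB.instance Definition _ := GRing.Lmodule.on (l1_space K n).

Definition l1_norm (x : l1_space K n) : K :=
  \sum_(i < n) `|(x : 'rV[K]_n) ord0 i|.

Let l1_normD (x y : l1_space K n) : l1_norm (x + y) <= l1_norm x + l1_norm y.
Proof.
by rewrite /l1_norm -big_split; apply: ler_sum => i _; rewrite mxE ler_normD.
Qed.

Let l1_normZ (a : K) (x : l1_space K n) : l1_norm (a *: x) = `|a| * l1_norm x.
Proof.
by rewrite /l1_norm mulr_sumr; apply: eq_bigr => i _; rewrite mxE normrM.
Qed.

Let l1_norm_eq0 (x : l1_space K n) : l1_norm x = 0 -> x = 0.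
Proof.
move=> /psumr_eq0P x0; apply/rowP => i; rewrite mxE; apply/eqP.
by rewrite -normr_eq0; apply/eqP/x0.
Qed.

HB.instance Definition _ :=
  @Lmodule_isNormed.Build K (l1_space K n) l1_norm l1_normD l1_normZ l1_norm_eq0.

Lemma l1_space_normE (x : l1_space K n) :
  `|x| = \sum_(i < n) `|(x : 'rV[K]_n) ord0 i|.
Proof. by []. Qed.

End l1_norm.

Lemma le_mx_norm (K : numFieldType) (n : nat) (x : 'rV[K]_n) i :
  `|x ord0 i| <= `|x|.
Proof.
rewrite [leRHS]mx_normE.
exact: (le_bigmax _ (fun ij => `|x ij.1 ij.2|%:nng) (ord0, i)).
Qed.

Lemma mx_norm_le_l1 (K : numFieldType) (n : nat) (x : l1_space K n) :
  `|x : 'rV[K]_n| <= `|x|.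
Proof.
have l1_ge0 : 0 <= `|x| by [].
rewrite [leLHS]mx_normE -[leRHS]/(NngNum l1_ge0)%:num num_le.
apply/bigmax_leP; split=> [|[j i] _]; first by rewrite -num_le.
rewrite -num_le /= l1_space_normE ord1 (bigD1 i)//= lerDl.
by apply: sumr_ge0 => k _.
Qed.

Lemma l1_le_mx_norm (K : numFieldType) (n : nat) (x : l1_space K n) :
  `|x| <= n%:R * `|x : 'rV[K]_n|.
Proof.
rewrite l1_space_normE; apply: le_trans (ler_sum _ (fun i _ => le_mx_norm x i)) _.
by rewrite sumr_const card_ord mulr_natl.
Qed.

Definition norm_complete {K : numFieldType} (X : normedModType K) : Prop :=
  forall F : set_system X, ProperFilter F -> cauchy F -> cvg F.

Lemma linf_complete (K : numFieldType) (n : nat) :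
  norm_complete (K^o : normedModType K) ->
  norm_complete ('rV[K]_n : normedModType K).
Proof.
move=> Kc.
pose KC : completeType := HB.pack (K : Type) (Uniform.on K^o) (Pointed.on K^o)
   (Uniform_isComplete.Build K^o Kc).
exact: (@mx_complete KC 1 n).
Qed.

Lemma l1_complete (K : numFieldType) (n : nat) :
  norm_complete (K^o : normedModType K) ->
  norm_complete (l1_space K n : normedModType K).
Proof.
move=> Kc F FF /cauchy_ballP Fc.
have : cauchy (F : set_system 'rV[K]_n).
  apply/cauchy_ballP => e e0; apply: filterS (Fc _ e0) => -[x y] /=.
  rewrite -!ball_normE /=; apply: le_lt_trans.
  exact: (@mx_norm_le_l1 K n (x - y)).
move=> /(linf_complete Kc)/cvg_ex[/= l Fl]; apply/cvg_ex; exists l.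
apply/cvgrPdist_lt => e e0.
have ne0 : 0 < e / n.+1%:R by rewrite divr_gt0.
have /cvgrPdist_lt/(_ _ ne0) := Fl; apply: filterS => x.
rewrite ltr_pdivlMr// mulrC; apply: le_lt_trans.
apply: le_trans (@l1_le_mx_norm K n (l - x)) _.
by rewrite ler_wpM2r// ler_nat.
Qed.

Lemma complex_complete (R : realType) :
  norm_complete (R[i]^o : normedModType R[i]).
Proof.
move=> F FF /cauchy_ballP Fc.
have le_Re (z : R[i]) : `|complex.Re z|%:C%C <= `|z| by exact: normc_ge_Re.
have le_Im (z : R[i]) : `|complex.Im z|%:C%C <= `|z|.
  rewrite normc_def lecR -sqrtr_sqr; apply: ler_wsqrtr.
  by rewrite lerDr sqr_ge0.
have projc (f : R[i] -> R) : (forall x y, f (x - y) = f x - f y) ->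
    (forall z, `|f z|%:C%C <= `|z|) -> cvg (f @ F).
  move=> fB f_le; apply: cauchy_cvg; apply/cauchy_ballP => e e0.
  have eC0 : 0 < e%:C%C by rewrite ltcR.
  rewrite near_map2; apply: filterS (Fc _ eC0) => -[x y] /=.
  rewrite -!ball_normE /= => xye.
  by rewrite -fB -ltcR; exact: le_lt_trans xye.
have /cvg_ex[/= a Fa] := projc (@complex.Re R) (fun x y => raddfB (@complex.Re R) x y) le_Re.
have /cvg_ex[/= b Fb] := projc (@complex.Im R) (fun x y => raddfB (@complex.Im R) x y) le_Im.
apply/cvg_ex; exists (a +i* b)%C; apply/cvgrPdist_lt => e e0.
have /complex_realP[r er] : e \is Num.real by exact: gtr0_real.
have r20 : 0 < r / 2 by rewrite divr_gt0// -ltcR -er.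
have /cvgrPdist_lt/(_ _ r20) Har := Fa; have /cvgrPdist_lt/(_ _ r20) Hbr := Fb.
near=> z.
have -> : (a +i* b)%C - z = (a - complex.Re z)%:C%C + 'i%C * (b - complex.Im z)%:C%C.
  by rewrite [LHS]complexE; case: (z).
apply: le_lt_trans (ler_normD _ _) _.
have normI : `|'i%C : R[i]| = 1 by rewrite normc_def/= expr0n expr1n add0r sqrtr1.
have normR (t : R) : `|t%:C%C| = `|t|%:C%C.
  by rewrite normc_def/= expr0n addr0 sqrtr_sqr.
rewrite normrM normI mul1r !normR er (splitr r) rmorphD/=.
by apply: ltrD; rewrite ltcR; near: z.
Unshelve. all: by end_near. Qed.

(* [norm_complete X] is the statement packed into [completeNormedModType]; the
   carrier, linear structure and norm of [banach Xc] are those of X. *)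
Definition banach (K : numFieldType) (X : normedModType K)
    (Xc : norm_complete X) : completeNormedModType K :=
  HB.pack (X : Type) (NormedModule.on X) (Uniform_isComplete.Build X Xc).

(* The scalar field is either R or R[i]; [k] selects which. *)
Variant scalar_kind := Real_scalars | Complex_scalars.

Definition scalar_field (R : realType) (k : scalar_kind) : numFieldType :=
  match k with Real_scalars => R | Complex_scalars => R[i] end.

Lemma scalar_complete (R : realType) (k : scalar_kind) :
  norm_complete ((scalar_field R k)^o : normedModType (scalar_field R k)).
Proof. by case: k; [exact: R_complete|exact: complex_complete]. Qed.

Section spaces.
Variables (R : realType) (k : scalar_kind).
Local Notation K := (scalar_field R k).

Definition scalar_line : completeNormedModType K := banach (@scalar_complete R k).

Definition l1 (n : nat) : completeNormedModType K :=
  banach (l1_complete (n := n) (@scalar_complete R k)).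

(* the library norm on ['rV[K]_n] is the maximum of the moduli of the entries *)
Definition linf (n : nat) : completeNormedModType K :=
  banach (linf_complete (n := n) (@scalar_complete R k)).

End spaces.

Lemma opnorm_isLub (R : realType) (k : scalar_kind)
    (X Y : completeNormedModType (scalar_field R k)) (T : {linear X -> Y}) :
  bounded_operator T ->
  isLub [set `|T x| | x in [set x : X | `|x| <= 1]] (opnorm T).
Proof.
pose nT := [set `|T x| | x in [set x : X | `|x| <= 1]].
suff lubT : bounded_operator T -> exists c, supremums nT c.
  move=> /lubT[c cs]; rewrite /opnorm /supremum -/nT ifF.
    by case: xgetP => [? -> //|/(_ c)].
  by apply/negbTE/set0P; exists `|T 0|; exists 0 => //=; rewrite normr0.
rewrite {}/nT.
move=> /linear_boundedP Tb.
have [M M0 TM] : exists2 M : scalar_field R k, 0 < M & forall x, `|T x| <= M * `|x|.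
  move: Tb => /pinfty_ex_gt0[M M0 h]; by exists M.
have ub : ubound [set `|T x| | x in [set x : X | `|x| <= 1]] M.
  move=> _ [x /= x1 <-]; apply: le_trans (TM x) _.
  by rewrite -[leRHS]mulr1 ler_wpM2l// ltW.
case: k X Y T Tb M M0 TM ub => X Y T _ M M0 TM ub.
- exists (sup [set `|T x| | x in [set x : X | `|x| <= 1]]).
  have hs : has_sup [set `|T x| | x in [set x : X | `|x| <= 1]].
    split; last by exists M.
    by exists `|T 0|; exists 0 => //=; rewrite normr0.
  split; first by apply: sup_upper_bound.
  by move=> y yu; apply: ge_sup => //; case: hs.
- pose A := [set complex.Re (`|T x| : R[i]) | x in [set x : X | `|x| <= 1]].
  have nR (x : X) : (`|T x| : R[i]) = (complex.Re (`|T x| : R[i]))%:C%C.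
    by rewrite RRe_real// ger0_real.
  have hs : has_sup A.
    split; first by exists (complex.Re (`|T 0| : R[i])); exists 0 => //=; rewrite normr0.
    exists (complex.Re (M:R[i])) => _ [x x1 <-].
    have : (`|T x| : R[i]) <= M by apply: ub; exists x.
    by rewrite lecE => /andP[].
  exists ((sup A)%:C%C : R[i]); split.
    move=> _ [x x1 <-]; rewrite nR; rewrite lecR; apply: sup_upper_bound => //.
    by exists x.
  move=> y yu.
  have y0 : (`|T 0| : R[i]) <= y by apply: yu; exists 0 => //=; rewrite normr0.
  have yr : (y : R[i]) = (complex.Re (y : R[i]))%:C%C.
    rewrite RRe_real// ger0_real//; exact: le_trans y0.
  rewrite yr lecR; apply: ge_sup; first by case: hs.
  move=> _ [x x1 <-].
  have : (`|T x| : R[i]) <= y by apply: yu; exists x.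
  by rewrite lecE => /andP[].
Qed.

(* Main.v *)
Require Import Defs.
From HB Require Import structures.
From mathcomp Require Import all_boot all_order all_algebra.
From mathcomp Require Import all_classical all_reals all_analysis.
From mathcomp Require Import ring.

(** Neither unit ball is strictly convex or smooth: an arbitrarily small change of
a functional can move all the points where it attains its norm far away, and an
arbitrarily small change of a point can do the same to the norm-one functionals
attaining their norm at it. Both properties forbid this. In each case everything happens in two coordinates [i] and [j], so that the dimension
enters only through the existence of two of them. Write [(c, d)] for a vector or
for a functional supported there, and let [t] tend to 0.

- [l1], fixed operator. [T = (1, 0)] has value [1 - t] at the unit vector
  [(1 - t, t)], but a norm-one [S] that attains its norm at this point must have
  a second coefficient of modulus 1, while that of [T] is 0.
- [l1], fixed point. [T = (1, 1 - t)] has value [1 - t/2] at [(1/2, 1/2)], but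
  attains its norm only at multiples of the first basis vector.
- [linf], fixed operator. [T = (1/2, 1/2)] has value [1 - t/2] at the unit vector
  [(1, 1 - t)], but a norm-one [S] attaining its norm there has a zero second
  coefficient: changing the second entry of the vector by any amount of modulus
  at most [t] stays in the unit ball, and [S] would exceed 1 at one of these
  vectors otherwise ([scalar_inward_eq0]).
- [linf], fixed point. [T = (1 - t, t)] has value [1 - t] at [(1, 0)], but attains
  its norm only at vectors whose second entry has modulus 1.

[not_property_Lpo] and [not_property_Lop] turn such families, with a distance
bounded below independently of [t], into a failure of the property; they need
every [eta > 0] to dominate an admissible [t] ([small_defect]). *)

Set Implicit Arguments.
Unset Strict Implicit.
Unset Printing Implicit Defensive.

Import Order.TTheory GRing.Theory Num.Theory.
Import numFieldNormedType.Exports.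

Local Open Scope classical_set_scope.
Local Open Scope ring_scope.

(** * Criteria for the failure of the two properties *)

Section operators.
Variables (R : realType) (k : scalar_kind).
Local Notation K := (scalar_field R k).
Variables X Y : completeNormedModType K.

Lemma bounded_operatorP (T : {linear X -> Y}) :
  bounded_operator T <->
  exists2 M : K, 0 <= M & forall x, `|T x| <= M * `|x|.
Proof.
split=> [/linear_boundedP/pinfty_ex_gt0[M M0 TM]|[M M0 TM]].
  by exists M => //; exact: ltW.
apply/linear_boundedP; near=> N => x; apply: le_trans (TM x) _.
rewrite ler_wpM2r//; near: N; apply: nbhs_pinfty_ge; exact: ger0_real.
Unshelve. all: by end_near. Qed.

Lemma bounded_operatorB (S T : {linear X -> Y}) :
  bounded_operator S -> bounded_operator T ->
  bounded_operator (S \- T : {linear X -> Y}).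
Proof.
move=> /bounded_operatorP[M M0 SM] /bounded_operatorP[N N0 TN].
apply/bounded_operatorP; exists (M + N); first exact: addr_ge0.
by move=> x /=; rewrite (le_trans (ler_normB _ _))// mulrDl lerD.
Qed.

Lemma le_opnorm (T : {linear X -> Y}) (x : X) :
  bounded_operator T -> `|x| <= 1 -> `|T x| <= opnorm T.
Proof. by move=> /opnorm_isLub[ubT _] x1; apply: ubT; exists x. Qed.

(** Recognizes norm-one operators by an inequality on all vectors and a single
point of equality, so that no supremum has to be computed. *)
Lemma contraction_opnorm1 (T : {linear X -> Y}) (x : X) :
  (forall y, `|T y| <= `|y|) -> `|x| = 1 -> `|T x| = 1 ->
  bounded_operator T /\ opnorm T = 1.
Proof.
move=> Tle x1 Tx1; have Tb : bounded_operator T.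
  by apply/bounded_operatorP; exists 1 => // y; rewrite mul1r.
split=> //; apply/eqP; rewrite eq_le -{2}Tx1 le_opnorm ?x1// andbT.
have [_ lubT] := opnorm_isLub Tb; apply: lubT => _ [y y1 <-].
exact: le_trans (Tle y) y1.
Qed.

(** In a field such as R[i] the order is partial and no minimum of [eta] and 1 is
at hand; the formula [eta / (1 + eta)] replaces it. *)
Lemma small_defect (eta : K) :
  0 < eta -> exists t : K, [/\ 0 < t, t < 1 & t < eta].
Proof.
move=> eta0; have s0 : 0 < 1 + eta by rewrite addr_gt0.
exists (eta / (1 + eta)); split; first by rewrite divr_gt0.
  by rewrite ltr_pdivrMr// mul1r ltrDr.
by rewrite ltr_pdivrMr// ltr_pMr// ltrDl.
Qed.

(** A distance between operators is witnessed by one vector [u] of the unit ball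
at which their values differ by at least [e], and the norm of [S] is used only as
a bound on the ball: this leaves conditions in which no operator norm occurs. *)
Lemma not_property_Lpo (e : K) (T : {linear X -> Y}) (x1 : X) :
  0 < e -> (forall y, `|T y| <= `|y|) -> `|x1| = 1 -> `|T x1| = 1 ->
  (forall t : K, 0 < t -> t < 1 -> exists x : X, [/\ `|x| = 1, 1 - t <= `|T x| &
     forall S : {linear X -> Y}, (forall u, `|u| <= 1 -> `|S u| <= 1) ->
       `|S x| = 1 -> exists2 u, `|u| <= 1 & e <= `|S u - T u|]) ->
  ~ property_Lpo X Y.
Proof.
move=> e0 Tle x11 Tx1 far Lpo.
have [Tb T1] := contraction_opnorm1 Tle x11 Tx1.
have [eta eta0 near_attain] := Lpo e T e0 Tb T1.
have [t [t0 t1 teta]] := small_defect eta0.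
have [x [xn Tx farS]] := far t t0 t1.
have [|S [Sb S1 Sx ST]] := near_attain x xn.
  by apply: lt_le_trans Tx; rewrite ltrD2l ltrN2.
have [|u u1 eu] := farS S _ Sx.
  by move=> u u1; rewrite -S1 le_opnorm.
have := le_opnorm (bounded_operatorB Sb Tb) u1.
by move=> /(le_trans eu) /le_lt_trans /(_ ST); rewrite ltxx.
Qed.

Lemma not_property_Lop (e : K) (x : X) :
  0 < e -> `|x| = 1 ->
  (forall t : K, 0 < t -> t < 1 -> exists T : {linear X -> Y},
    [/\ forall y, `|T y| <= `|y|, exists2 y, `|y| = 1 & `|T y| = 1,
        1 - t <= `|T x| &
        forall y, `|y| = 1 -> `|T y| = 1 -> e <= `|y - x|]) ->
  ~ property_Lop X Y.
Proof.
move=> e0 x1 far Lop; have [eta eta0 near_attain] := Lop e x e0 x1.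
have [t [t0 t1 teta]] := small_defect eta0.
have [T [Tle [y y1 Ty] Tx farT]] := far t t0 t1.
have [Tb T1] := contraction_opnorm1 Tle y1 Ty.
have [|x0 [x01 Tx0 x0x]] := near_attain T Tb T1.
  by apply: lt_le_trans Tx; rewrite ltrD2l ltrN2.
by have := le_lt_trans (farT x0 x01 Tx0) x0x; rewrite ltxx.
Qed.

End operators.

(** * Two-coordinate vectors and functionals *)

(** A ball of positive radius around a point of modulus 1 leaves the unit ball. The choice
of [w] that aligns [w * b] with [c] avoids conjugation and so works over the real
and the complex scalars at once. *)
Lemma scalar_inward_eq0 (K : numFieldType) (c b t : K) :
  0 < t -> `|c| = 1 -> (forall w : K, `|w| <= t -> `|c + w * b| <= 1) -> b = 0.
Proof.
move=> t0 c1 cb; apply/eqP; apply: contraT => b0.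
have /cb : `|t * c * (`|b| / b)| <= t.
  by rewrite !normrM c1 normfV normr_id mulfV ?normr_eq0// !mulr1 gtr0_norm.
have -> : c + t * c * (`|b| / b) * b = c * (1 + t * `|b|) by field.
have tb0 : 0 < t * `|b| by rewrite mulr_gt0// normr_gt0.
rewrite normrM c1 mul1r gtr0_norm ?addr_gt0//.
by rewrite gerDl => /(lt_le_trans tb0); rewrite ltxx.
Qed.

Section two_coordinates.
Variables (K : numFieldType) (n : nat) (i j : 'I_n).
Hypothesis ij : i != j.

Definition vec2 (a b : K) : 'rV[K]_n :=
  a *: delta_mx ord0 i + b *: delta_mx ord0 j.

(** The codomain is [K^o] so that linearity refers to scaling by scalars. *)
Definition form2 (a b : K) (x : 'rV[K]_n) : K^o :=
  a * x ord0 i + b * x ord0 j.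

Lemma form2_linear a b : linear (form2 a b).
Proof.
by move=> c x y; rewrite /form2 !mxE /GRing.scale/=; ring.
Qed.

Lemma vec2_i a b : vec2 a b ord0 i = a.
Proof. by rewrite !mxE !eqxx (negbTE ij) mulr1 mulr0 addr0. Qed.

Lemma vec2_j a b : vec2 a b ord0 j = b.
Proof. by rewrite !mxE !eqxx eq_sym (negbTE ij) mulr1 mulr0 add0r. Qed.

Lemma sub_vec2_j (x : 'rV[K]_n) a b :
  (x - vec2 a b) ord0 j = x ord0 j - b.
Proof. by rewrite 2!mxE vec2_j. Qed.

Lemma form2_vec2 a b c d : form2 a b (vec2 c d) = a * c + b * d.
Proof. by rewrite /form2 vec2_i vec2_j. Qed.

Lemma norm_form2_le a b x :
  `|form2 a b x| <= `|a| * `|x ord0 i| + `|b| * `|x ord0 j|.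
Proof. by rewrite -!normrM ler_normD. Qed.

Lemma sum_coords2 (F : 'I_n -> K) :
  \sum_l F l = F i + F j + \sum_(l | (l != i) && (l != j)) F l.
Proof. by rewrite (bigD1 i)//= (bigD1 j) ?addrA//= eq_sym. Qed.

Lemma l1_norm_vec2 a b : `|vec2 a b : l1_space K n| = `|a| + `|b|.
Proof.
rewrite l1_space_normE sum_coords2 vec2_i vec2_j big1 ?addr0// => l /andP[li lj].
by rewrite !mxE !eqxx (negbTE li) (negbTE lj) !mulr0 addr0 normr0.
Qed.

Lemma coords2_le_l1_norm (x : l1_space K n) :
  `|(x : 'rV_n) ord0 i| + `|(x : 'rV_n) ord0 j| <= `|x|.
Proof. by rewrite l1_space_normE sum_coords2 lerDl sumr_ge0. Qed.

Lemma linf_norm_vec2_le1 a b : `|a| <= 1 -> `|b| <= 1 -> `|vec2 a b| <= 1.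
Proof.
move=> a1 b1; rewrite [leLHS]mx_normE -[leRHS]/(NngNum (@ler01 K))%:num num_le.
apply/bigmax_leP; split=> [|[l m] _]; first by rewrite -num_le.
rewrite -num_le /= ord1 !mxE eqxx /=.
have [->|mi] := eqVneq m i; first by rewrite (negbTE ij) mulr1 mulr0 addr0.
by have [_|mj] := eqVneq m j; rewrite ?mulr1 !mulr0 ?add0r ?addr0 ?normr0.
Qed.

Lemma form2_le_l1 a b (x : l1_space K n) :
  `|a| <= 1 -> `|b| <= 1 -> `|form2 a b x| <= `|x|.
Proof.
move=> a1 b1; apply: le_trans (norm_form2_le a b x) _.
by apply: le_trans (coords2_le_l1_norm x); apply: lerD; rewrite ler_piMl.
Qed.

Lemma form2_le_linf a b (x : 'rV[K]_n) :
  `|a| + `|b| <= 1 -> `|form2 a b x| <= `|x|.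
Proof.
move=> ab1; apply: le_trans (norm_form2_le a b x) _.
apply: (@le_trans _ _ ((`|a| + `|b|) * `|x|)); last by rewrite ler_piMl.
by rewrite mulrDl lerD// ler_wpM2l// le_mx_norm.
Qed.

End two_coordinates.

(** * The four failures *)

Section failures.
Variables (R : realType) (k : scalar_kind) (n : nat) (i j : 'I_n).
Hypothesis ij : i != j.
Local Notation K := (scalar_field R k).
Local Notation Y := (scalar_line R k).
Local Notation l1v := (vec2 i j : K -> K -> l1 R k n).
Local Notation linfv := (vec2 i j : K -> K -> linf R k n).

Definition l1_form (a b : K) : {linear l1 R k n -> Y} :=
  HB.pack (form2 i j a b : l1 R k n -> Y)
    (GRing.isLinear.Build K (l1 R k n) Y *:%R (form2 i j a b)
      (@form2_linear K n i j a b)).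

Definition linf_form (a b : K) : {linear linf R k n -> Y} :=
  HB.pack (form2 i j a b : linf R k n -> Y)
    (GRing.isLinear.Build K (linf R k n) Y *:%R (form2 i j a b)
      (@form2_linear K n i j a b)).

Lemma l1_form_le a b (x : l1 R k n) :
  `|a| <= 1 -> `|b| <= 1 -> `|l1_form a b x| <= `|x|.
Proof. exact: form2_le_l1. Qed.

Lemma linf_form_le a b (x : linf R k n) :
  `|a| + `|b| <= 1 -> `|linf_form a b x| <= `|x|.
Proof. exact: form2_le_linf. Qed.

Lemma norm_l1_form a b c d : `|l1_form a b (l1v c d)| = `|a * c + b * d|.
Proof. by rewrite -(form2_vec2 ij). Qed.

Lemma norm_linf_form a b c d : `|linf_form a b (linfv c d)| = `|a * c + b * d|.
Proof. by rewrite -(form2_vec2 ij). Qed.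

Lemma norm_l1v a b : `|l1v a b| = `|a| + `|b|.
Proof. exact: l1_norm_vec2. Qed.

Lemma norm_linfv_le1 a b : `|a| <= 1 -> `|b| <= 1 -> `|linfv a b| <= 1.
Proof. exact: linf_norm_vec2_le1. Qed.

Lemma norm_linfv_1l b : `|b| <= 1 -> `|linfv 1 b| = 1.
Proof.
move=> b1; apply/eqP; rewrite eq_le norm_linfv_le1 ?normr1//=.
by have := le_mx_norm (vec2 i j 1 b) i; rewrite (vec2_i ij) normr1.
Qed.

Lemma l1_linearE (S : {linear l1 R k n -> Y}) a b :
  S (l1v a b) = a * (S (l1v 1 0) : K) + b * (S (l1v 0 1) : K) :> K.
Proof.
have -> : l1v a b = a *: l1v 1 0 + b *: l1v 0 1.
  by rewrite /vec2 !scale1r !scale0r addr0 add0r.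
by rewrite linearD !linearZ.
Qed.

Lemma linf_linearE (S : {linear linf R k n -> Y}) a b :
  S (linfv a b) = a * (S (linfv 1 0) : K) + b * (S (linfv 0 1) : K) :> K.
Proof.
have -> : linfv a b = a *: linfv 1 0 + b *: linfv 0 1.
  by rewrite /vec2 !scale1r !scale0r addr0 add0r.
by rewrite linearD !linearZ.
Qed.

Let norm_half : `|2^-1 : K| = 2^-1. Proof. by rewrite normfV normr_nat. Qed.
Let half_half : 2^-1 + 2^-1 = 1 :> K. Proof. by rewrite [RHS](splitr 1) mul1r. Qed.
Let norm_compl (t : K) : t < 1 -> `|1 - t| = 1 - t.
Proof. by move=> t1; rewrite gtr0_norm// subr_gt0. Qed.

Lemma l1_not_Lpo : ~ property_Lpo (l1 R k n) Y.
Proof.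
apply: (@not_property_Lpo R k _ _ 1 (l1_form 1 0) (l1v 1 0)) => //.
- by move=> y; rewrite l1_form_le ?normr1 ?normr0.
- by rewrite norm_l1v normr1 normr0 addr0.
- by rewrite norm_l1_form mul1r mul0r addr0 normr1.
move=> t t0 t1; exists (l1v (1 - t) t); split.
- by rewrite norm_l1v norm_compl// gtr0_norm// subrK.
- by rewrite norm_l1_form mul1r mul0r addr0 norm_compl.
move=> S Sle; rewrite l1_linearE => Sx.
have e1 : `|l1v 1 0| <= 1 by rewrite norm_l1v normr1 normr0 addr0.
have e2 : `|l1v 0 1| <= 1 by rewrite norm_l1v normr1 normr0 add0r.
exists (l1v 0 1) => //.
have -> : l1_form 1 0 (l1v 0 1) = 0 by rewrite [LHS](form2_vec2 ij) mulr0 mul0r addr0.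
(* [1 <= |S e_j|] follows from [1 <= (1 - t) + t * |S e_j|]. *)
rewrite subr0 -(ler_pM2l t0) mulr1 -(lerD2l (1 - t)) subrK -[leLHS]Sx.
apply: le_trans (ler_normD _ _) _.
rewrite !normrM norm_compl// (gtr0_norm t0) lerD2r ler_piMr ?subr_ge0 ?(ltW t1)//.
exact: Sle.
Qed.

Lemma l1_not_Lop : ~ property_Lop (l1 R k n) Y.
Proof.
apply: (@not_property_Lop R k _ _ 2^-1 (l1v 2^-1 2^-1)); first by rewrite invr_gt0.
  by rewrite norm_l1v norm_half.
move=> t t0 t1; exists (l1_form 1 (1 - t)); split.
- move=> y; rewrite l1_form_le ?normr1// norm_compl//.
  by rewrite gerBl ltW.
- exists (l1v 1 0); first by rewrite norm_l1v normr1 normr0 addr0.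
  by rewrite norm_l1_form mulr1 mulr0 addr0 normr1.
- rewrite norm_l1_form mul1r mulrBl mul1r addrA half_half.
  rewrite ger0_norm ?subr_ge0.
    by rewrite lerD2l lerN2 ler_piMr ?ltW// invf_lt1// ltr1n.
  by rewrite mulr_ile1 ?invr_ge0 ?ltW// invf_lt1// ltr1n.
move=> y y1 Ty.
have yij : `|(y : 'rV[K]_n) ord0 i| + `|(y : 'rV[K]_n) ord0 j| <= 1.
  by rewrite -[leRHS]y1; exact: coords2_le_l1_norm.
(* The missing mass [t * |y_j|] has to vanish, as [|y_i| + |y_j| <= 1]. *)
have yj0 : (y : 'rV[K]_n) ord0 j = 0.
  apply/eqP; rewrite -normr_le0 -(pmulr_rle0 _ t0).
  have := norm_form2_le i j 1 (1 - t) y.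
  have -> : `|form2 i j 1 (1 - t) y| = 1 by exact: Ty.
  rewrite normr1 mul1r norm_compl// mulrBl mul1r addrA => h.
  by move: (le_trans h (lerD yij (lexx _))); rewrite lerDl oppr_ge0.
apply: le_trans (coords2_le_l1_norm ij (y - l1v 2^-1 2^-1)).
rewrite [X in _ <= _ + `|X|](_ : _ = - 2^-1).
  by rewrite normrN norm_half lerDr.
by apply: etrans (sub_vec2_j ij y 2^-1 2^-1) _; rewrite yj0 sub0r.
Qed.

Lemma linf_not_Lpo : ~ property_Lpo (linf R k n) Y.
Proof.
apply: (@not_property_Lpo R k _ _ 2^-1 (linf_form 2^-1 2^-1) (linfv 1 1)).
- by rewrite invr_gt0.
- by move=> y; rewrite linf_form_le// !norm_half half_half.
- by rewrite norm_linfv_1l ?normr1.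
- by rewrite norm_linf_form !mulr1 half_half normr1.
move=> t t0 t1; exists (linfv 1 (1 - t)).
have t1n : `|1 - t| <= 1 by rewrite norm_compl// gerBl ltW.
split.
- by rewrite norm_linfv_1l.
- rewrite norm_linf_form mulr1 mulrBr mulr1 addrA half_half.
  rewrite ger0_norm ?subr_ge0.
    by rewrite lerD2l lerN2 ler_piMl ?ltW// invf_lt1// ltr1n.
  by rewrite mulr_ile1 ?invr_ge0 ?ltW// invf_lt1// ltr1n.
move=> S Sle; rewrite linf_linearE => Sx.
have Sj0 : S (linfv 0 1) = 0 :> K.
  apply: (scalar_inward_eq0 t0 Sx) => w wt.
  have := Sle (linfv 1 (1 - t + w)); rewrite linf_linearE mulrDl addrA; apply.
  apply: norm_linfv_le1; first by rewrite normr1.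
  apply: le_trans (ler_normD _ _) _; rewrite norm_compl//.
  by rewrite -[leRHS](subrK t) lerD2l.
exists (linfv 0 1); first by rewrite norm_linfv_le1 ?normr0 ?normr1.
have -> : S (linfv 0 1) - linf_form 2^-1 2^-1 (linfv 0 1) = - 2^-1 :> K.
  by rewrite [X in X - _ = _]Sj0 sub0r [X in - X](form2_vec2 ij) mulr0 add0r mulr1.
by rewrite [leRHS]normrN norm_half.
Qed.

Lemma linf_not_Lop : ~ property_Lop (linf R k n) Y.
Proof.
apply: (@not_property_Lop R k _ _ 1 (linfv 1 0)) => //.
  by rewrite norm_linfv_1l// normr0.
move=> t t0 t1; exists (linf_form (1 - t) t); split.
- by move=> y; rewrite linf_form_le// norm_compl// gtr0_norm// subrK.
- exists (linfv 1 1); first by rewrite norm_linfv_1l ?normr1.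
  by rewrite norm_linf_form !mulr1 subrK normr1.
- by rewrite norm_linf_form mulr1 mulr0 addr0 norm_compl.
move=> y y1 Ty.
have yi : `|(y : 'rV[K]_n) ord0 i| <= 1 by rewrite -[leRHS]y1; exact: le_mx_norm.
have yj : 1 <= `|(y : 'rV[K]_n) ord0 j|.
  have := norm_form2_le i j (1 - t) t y.
  have -> : `|form2 i j (1 - t) t y| = 1 by exact: Ty.
  rewrite norm_compl// (gtr0_norm t0) => h.
  rewrite -(ler_pM2l t0) mulr1 -(lerD2l (1 - t)) subrK.
  by apply: le_trans h _; rewrite lerD2r ler_piMr// subr_ge0 ltW.
apply: le_trans yj (le_trans _ (le_mx_norm (y - linfv 1 0) j)).
rewrite [X in _ <= `|X|](_ : _ = (y : 'rV[K]_n) ord0 j)//.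
by apply: etrans (sub_vec2_j ij y 1 0) _; rewrite subr0.
Qed.

End failures.

Theorem proposition2p5 (R : realType) (k : scalar_kind) (n : nat) :
  (2 <= n)%N ->
  (~ property_Lpo (l1 R k n) (scalar_line R k) /\
   ~ property_Lop (l1 R k n) (scalar_line R k)) /\
  (~ property_Lpo (linf R k n) (scalar_line R k) /\
   ~ property_Lop (linf R k n) (scalar_line R k)).
Proof.
move=> n2; have n1 := ltnW n2.
have ij : Ordinal n1 != Ordinal n2 by [].
by split; split; [exact: l1_not_Lpo ij|exact: l1_not_Lop ij
                 |exact: linf_not_Lpo ij|exact: linf_not_Lop ij].
Qed.
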